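(* (Immersion of $\mathbb F$ in $\mathbb G$ under $\mathbf P$ is not assumed.) The following conditions are equivalent: (1) $\mathcal I(\mathbf P)\neq\emptyset$, i.e. there exists a probability measure equivalent to $\mathbf P$ under which $\mathbb F$ is immersed in $\mathbb G$. (2) There exists a probability measure $\mathbf Q\sim\mathbf P$ such that every $(\mathbb F,\mathbf P)$-martingale is a $(\mathbb G,\mathbf Q)$-martingale.
   Context: $(\Omega,\mathcal G,\mathbb F=(\mathcal F_t)_{t\ge0},\mathbf P)$ is a filtered probability space satisfying the usual assumptions. $\tau:\Omega\to[0,\infty]$ is a random time (a $\mathcal G$-measurable random variable). The progressively enlarged filtration is $\mathbb G=(\mathcal G_t)_{t\ge0}$, $\mathcal G_t=\bigcap_{s>t}(\mathcal F_s\vee\sigma(\tau\wedge s))$. ''$\mathbb F$ is immersed in $\mathbb G$ under $\mathbf Q$'' means: every $(\mathbb F,\mathbf Q)$-martingale is a $(\mathbb G,\mathbf Q)$-martingale. $\mathcal I(\mathbf P)$ is the set of all probability measures $\mathbf Q$ on $\mathcal G$ that are equivalent to $\mathbf P$ and such that $\mathbb F$ is immersed in $\mathbb G$ under $\mathbf Q$. *)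

(* Defs.v *)
From HB Require Import structures.
From mathcomp Require Import all_boot all_order all_algebra.
From mathcomp Require Import all_classical all_reals all_analysis.
From mathcomp Require Import measurable_realfun.

Set Implicit Arguments.
Unset Strict Implicit.
Unset Printing Implicit Defensive.

Import Order.TTheory GRing.Theory Num.Theory.
Import numFieldNormedType.Exports.

Local Open Scope classical_set_scope.
Local Open Scope ring_scope.

(* The ambient sigma-algebra on the sample space T is [measurable]; its
   sub-sigma-algebras are set systems H : set (set T). Time is [0, +oo). *)

Section stochastic_basis.
Context {d : measure_display} {T : measurableType d} {R : realType}.

Record filtration (F : {nonneg R} -> set (set T)) : Prop := Filtration {
  filtration_sigma : forall t, sigma_algebra setT (F t) ;
  filtration_sub : forall t, F t `<=` measurable ;
  filtration_mono : forall s t, s <= t -> F s `<=` F t }.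

Record usual_conditions (P : probability T R)
    (F : {nonneg R} -> set (set T)) : Prop := UsualConditions {
  usual_complete : measure_is_complete P ;
  usual_null : forall N, measurable N -> P N = 0%E -> F 0%:nng N ;
  usual_right_continuous :
    forall t, F t = \bigcap_(s in [set s | t < s]) F s }.

Record random_time (tau : T -> \bar R) : Prop := RandomTime {
  random_time_measurable : measurable_fun setT tau ;
  random_time_ge0 : forall w, (0 <= tau w)%E }.

Definition progressive_enlargement (F : {nonneg R} -> set (set T))
    (tau : T -> \bar R) (t : {nonneg R}) : set (set T) :=
  \bigcap_(s in [set s | t < s])
    <<s F s `|` g_sigma_algebra_preimage
                  (fun w => Order.min (tau w) (s%:num)%:E) >>.

(* [g_sigma_algebraType H] is T equipped with <<s H >>, which is H itself when
   H is a sigma-algebra. *)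
Definition measurable_wrt (H : set (set T)) (X : T -> R) : Prop :=
  measurable_fun [set: g_sigma_algebraType H] (X : g_sigma_algebraType H -> R).

(* Y is a version of the conditional expectation E_Q[X | H]. *)
Definition cond_exp_version (Q : probability T R) (H : set (set T))
    (X Y : T -> R) : Prop :=
  [/\ measurable_wrt H Y,
      Q.-integrable setT (EFin \o Y) &
      forall A, H A ->
        (\int[Q]_(w in A) (Y w)%:E = \int[Q]_(w in A) (X w)%:E)%E].

Record martingale (Q : probability T R) (F : {nonneg R} -> set (set T))
    (M : {nonneg R} -> T -> R) : Prop := Martingale {
  martingale_adapted : forall t, measurable_wrt (F t) (M t) ;
  martingale_integrable : forall t, Q.-integrable setT (EFin \o M t) ;
  martingale_cond_exp :
    forall s t, s <= t -> cond_exp_version Q (F s) (M t) (M s) }.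

Definition immersed (Q : probability T R)
    (F G : {nonneg R} -> set (set T)) : Prop :=
  forall M, martingale Q F M -> martingale Q G M.

Definition equivalent_measures (Q P : probability T R) : Prop :=
  Q `<< P /\ P `<< Q.

Definition immersion_measures (P : probability T R)
    (F : {nonneg R} -> set (set T)) (tau : T -> \bar R) :
    set (probability T R) :=
  [set Q | equivalent_measures Q P /\
           immersed Q F (progressive_enlargement F tau)].

End stochastic_basis.

(* Main.v *)
Require Import Defs.
From HB Require Import structures.
From mathcomp Require Import all_boot all_order all_algebra.
From mathcomp Require Import all_classical all_reals all_analysis.
From mathcomp Require Import measurable_realfun.
From mathcomp Require Import lra.

Set Implicit Arguments.
Unset Strict Implicit.
Unset Printing Implicit Defensive.

Import Order.TTheory GRing.Theory Num.Theory.
Import numFieldNormedType.Exports.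

Local Open Scope classical_set_scope.
Local Open Scope ring_scope.

(** Under [Q], immersion of [F] in [G] amounts to the H-hypothesis: for [B] in
    [G s], the conditional probability [Q(B | F s)] also serves as [Q(B | F t)]
    for all [t >= s]. This condition already follows when all ([F], [P])-martingales
    are ([G], [Q])-martingales for some other [P]: applied to [P(A | F r)] with
    [A] in [F t], that assumption says that [P(A | F s)] is a version of
    [Q(A | G s)], hence also of [Q(A | F s)], so conditioning [B] on [F s] inside
    [Q(A n B)] loses nothing. Thus (2) gives (1) with the same [Q].
    Conversely, the H-hypothesis survives a change of measure from [Q] to
    [Z Q], with [Z = dP/dQ] on the sigma-algebra generated by all the [F t];
    since [Z Q = P] there, [F] has the same martingales under both. *)

(** * Finite measures given by an integrable density *)

Section density_measure.
Context d (T : measurableType d) (R : realType).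
Local Open Scope ereal_scope.
Variables (mu : {measure set T -> \bar R}) (X : T -> \bar R).
Hypotheses (X0 : forall x, 0 <= X x) (iX : mu.-integrable setT X).

(** The two proofs are carried by the term itself, so that the finite measure structure can be
    attached to it canonically. *)
Definition density_measure of (forall x, 0 <= X x) & mu.-integrable setT X :=
  fun A => \int[mu]_(x in A) X x.

Local Notation nu := (density_measure X0 iX).

Let density_measure0 : nu set0 = 0.
Proof. exact: integral_set0. Qed.

Let density_measure_ge0 A : 0 <= nu A.
Proof. exact: integral_ge0. Qed.

Let density_measure_sigma_additive : semi_sigma_additive nu.
Proof. exact: semi_sigma_additive_nng_induced (measurable_int mu iX) X0. Qed.

HB.instance Definition _ := isMeasure.Build _ _ _ nu
  density_measure0 density_measure_ge0 density_measure_sigma_additive.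

Let density_measure_fin : fin_num_fun nu.
Proof.
by move=> A mA; apply: integrable_fin_num => //; exact: integrableS iX.
Qed.

HB.instance Definition _ :=
  Measure_isFinite.Build _ _ _ nu density_measure_fin.

End density_measure.

(** The Radon-Nikodym derivative of [nu] with respect to [mu] has the same integrals as [X], hence
    equals [X] almost everywhere; change of variables for that derivative then gives the formula. *)
Lemma ge0_integral_density_measure d (T : measurableType d) (R : realType)
    (mu : {finite_measure set T -> \bar R}) (X f : T -> \bar R)
    (X0 : forall x, (0 <= X x)%E) (iX : mu.-integrable setT X) (A : set T) :
  measurable A -> measurable_fun setT f -> (forall x, 0 <= f x)%E ->
  (\int[density_measure X0 iX]_(x in A) f x =
   \int[mu]_(x in A) (f x * X x))%E.
Proof.
move=> mA mf f0; set nu := density_measure X0 iX.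
have numu : nu `<< mu.
  by apply/null_content_dominatesP => B mB muB; apply: null_set_integral => //;
    exact: measurable_funTS (measurable_int mu iX).
have mfA : measurable_fun A f by exact: measurable_funTS.
pose g := Radon_Nikodym_SigmaFinite.f nu mu.
have ig : mu.-integrable setT g by exact: Radon_Nikodym_SigmaFinite.f_integrable.
have gX : ae_eq mu setT g X.
  apply: integral_ae_eq => //; first exact: measurable_int iX.
  by move=> B _ mB; rewrite -Radon_Nikodym_SigmaFinite.f_integral.
rewrite -(Radon_Nikodym_SigmaFinite.change_of_variables numu)//.
have [mg mX] := (measurable_int mu ig, measurable_int mu iX).
apply: ae_eq_integral => //.
- by apply: emeasurable_funM => //; exact: measurable_funTS.
- by apply: emeasurable_funM => //; exact: measurable_funTS.
- by apply: ae_eqe_mul2l; exact: ae_eq_subset gX.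
Qed.

(** * Restriction of measures to a sub-sigma-algebra *)

Section sub_sigma_algebra.
Context d (T : measurableType d) (R : realType).
Implicit Types (H : set (set T)) (mu nu : {measure set T -> \bar R}).

Definition restrict_measure H of H `<=` measurable :=
  fun (mu : set T -> \bar R) (A : set (g_sigma_algebraType H)) => mu A.

Section restrict_measure_instance.
Variables (H : set (set T)) (Hm : H `<=` measurable).
Variable mu : {measure set T -> \bar R}.

Lemma g_sigma_algebra_sub : <<s H >> `<=` measurable.
Proof. exact: smallest_sub (sigma_algebra_measurable T) Hm. Qed.

Let restrict_measure0 : restrict_measure Hm mu set0 = 0%E.
Proof. exact: measure0. Qed.

Let restrict_measure_ge0 A : (0 <= restrict_measure Hm mu A)%E.
Proof. exact: measure_ge0. Qed.

Let restrict_measure_sigma_additive :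
  semi_sigma_additive (restrict_measure Hm mu).
Proof.
move=> F mF tF mUF.
apply: (@measure_semi_sigma_additive _ _ _ mu F _ tF); last first.
  exact: g_sigma_algebra_sub mUF.
by move=> i; exact: g_sigma_algebra_sub (mF i).
Qed.

HB.instance Definition _ := isMeasure.Build _ _ _ (restrict_measure Hm mu)
  restrict_measure0 restrict_measure_ge0 restrict_measure_sigma_additive.

End restrict_measure_instance.

Lemma restrict_measure_fin H (Hm : H `<=` measurable)
    (mu : {finite_measure set T -> \bar R}) :
  fin_num_fun (restrict_measure Hm mu).
Proof. by move=> A /(g_sigma_algebra_sub Hm); exact: fin_num_measure. Qed.

HB.instance Definition _ H (Hm : H `<=` measurable)
    (mu : {finite_measure set T -> \bar R}) :=
  Measure_isFinite.Build _ _ _ (restrict_measure Hm mu)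
    (restrict_measure_fin Hm mu).

Lemma measurable_fun_sub d' (U : sigmaRingType d') H (K : set (set T))
    (f : T -> U) : H `<=` <<s K >> ->
  measurable_fun [set: g_sigma_algebraType H] (f : g_sigma_algebraType H -> U) ->
  measurable_fun [set: g_sigma_algebraType K] (f : g_sigma_algebraType K -> U).
Proof.
move=> HK mf _ B mB; apply: (smallest_sub (smallest_sigma_algebra _ K) HK).
exact: mf.
Qed.

Lemma measurable_fun_ambient d' (U : sigmaRingType d') H (f : T -> U) :
  H `<=` measurable ->
  measurable_fun [set: g_sigma_algebraType H] (f : g_sigma_algebraType H -> U) ->
  measurable_fun setT f.
Proof. by move=> Hm mf _ B mB; apply: (g_sigma_algebra_sub Hm); exact: mf. Qed.

(** The restriction is the pushforward of [mu] under the identity, viewed as a map from the ambient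
    sigma-algebra to [<<s H >>]. *)
Lemma ge0_integral_restrict_measure H (Hm : H `<=` measurable) mu
    (f : T -> \bar R) (A : set T) : <<s H >> A ->
  measurable_fun [set: g_sigma_algebraType H]
    (f : g_sigma_algebraType H -> \bar R) ->
  (forall x, 0 <= f x)%E ->
  (\int[restrict_measure Hm mu]_(x in A) f x = \int[mu]_(x in A) f x)%E.
Proof.
move=> HA mf f0.
apply: (@ge0_integral_pushforward _ _ T (g_sigma_algebraType H) R idfun) => //.
- by move=> _ B mB; rewrite setTI; exact: (g_sigma_algebra_sub Hm).
- exact: measurable_funTS.
Qed.

Lemma eq_integral_sub H mu nu (f : T -> \bar R) (A : set T) :
  H `<=` measurable -> (forall B, <<s H >> B -> mu B = nu B) -> <<s H >> A ->
  measurable_fun [set: g_sigma_algebraType H]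
    (f : g_sigma_algebraType H -> \bar R) ->
  (\int[mu]_(x in A) f x = \int[nu]_(x in A) f x)%E.
Proof.
move=> Hm munu HA mf; rewrite integralE [RHS]integralE.
rewrite -!(ge0_integral_restrict_measure Hm)//;
  do ?[exact: measurable_funepos|exact: measurable_funeneg].
by congr (_ - _)%E; apply: eq_measure_integral => B mB _; exact: munu.
Qed.

(** The measures with densities [X] and [Y] agree on [<<s H >>], so they integrate [f] alike. This
    is the pull-out property that lets a conditional expectation replace the variable it comes
    from. *)
Lemma ge0_integral_mul_sub H (mu : {finite_measure set T -> \bar R})
    (X Y f : T -> \bar R) (A : set T) :
  H `<=` measurable ->
  (forall x, 0 <= X x)%E -> mu.-integrable setT X ->
  (forall x, 0 <= Y x)%E -> mu.-integrable setT Y ->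
  (forall B, <<s H >> B ->
    \int[mu]_(x in B) X x = \int[mu]_(x in B) Y x)%E ->
  measurable_fun [set: g_sigma_algebraType H]
    (f : g_sigma_algebraType H -> \bar R) -> (forall x, 0 <= f x)%E ->
  <<s H >> A ->
  (\int[mu]_(x in A) (f x * X x) = \int[mu]_(x in A) (f x * Y x))%E.
Proof.
move=> Hm X0 iX Y0 iY XY mf f0 HA.
have mfT := measurable_fun_ambient Hm mf.
have mA : measurable A := g_sigma_algebra_sub Hm HA.
rewrite -(ge0_integral_density_measure X0 iX)//.
rewrite -(ge0_integral_density_measure Y0 iY)//.
exact: eq_integral_sub mf.
Qed.

(** Radon-Nikodym is applied to the restrictions to [<<s H >>], which is what makes the density
    measurable with respect to [H]. *)
Lemma radon_nikodym_sub H (mu nu : {finite_measure set T -> \bar R}) :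
  H `<=` measurable ->
  (forall B, <<s H >> B -> mu B = 0 -> nu B = 0)%E ->
  exists Y : T -> R, [/\ measurable_wrt H Y, forall x, 0 <= Y x,
    mu.-integrable setT (EFin \o Y) &
    forall B, <<s H >> B -> nu B = (\int[mu]_(x in B) (Y x)%:E)%E].
Proof.
move=> Hm numu.
have /radon_nikodym_sigma_finite[g [g0 gfin /integrableP[mg ig] nug]] :
    restrict_measure Hm nu `<< restrict_measure Hm mu.
  by apply/null_content_dominatesP => B; exact: numu.
have gE : EFin \o (fine \o g) = g by apply/funext => x /=; rewrite fineK.
exists (fine \o g); split => //.
- exact: measurableT_comp.
- by move=> x; exact: fine_ge0.
- rewrite gE; apply/integrableP; split; first exact: measurable_fun_ambient mg.
  rewrite -(ge0_integral_restrict_measure Hm)//;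
    [exact: (@measurableT _ (g_sigma_algebraType H))|exact: measurableT_comp].
- move=> B HB.
  rewrite -[RHS](@ge0_integral_restrict_measure H Hm mu (EFin \o _))// gE//.
  exact: nug.
Qed.

End sub_sigma_algebra.

(** * Signed integrals and conditional probabilities *)

Section integral_lemmas.
Context d (T : measurableType d) (R : realType).
Local Open Scope ereal_scope.

Lemma integral_mul_indic (mu : {measure set T -> \bar R}) (D A : set T)
    (f : T -> \bar R) :
  \int[mu]_(x in D) (f x * (\1_A x)%:E) = \int[mu]_(x in D `&` A) f x.
Proof. by rewrite integral_mkcondr epatch_indic. Qed.

(** The four integrals of positive and negative parts are finite, so the terms can be moved across
    the equality. This brings signed integrands within reach of lemmas on nonnegative ones. *)
Lemma eq_integral_funeposneg (mu : {measure set T -> \bar R}) (A : set T)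
    (f g : T -> \bar R) : measurable A ->
  mu.-integrable setT f -> mu.-integrable setT g ->
  \int[mu]_(x in A) f x = \int[mu]_(x in A) g x <->
  \int[mu]_(x in A) (f^\+ x + g^\- x) = \int[mu]_(x in A) (f^\- x + g^\+ x).
Proof.
move=> mA intf intg.
have ifA : mu.-integrable A f by exact: integrableS intf.
have igA : mu.-integrable A g by exact: integrableS intg.
have [mf mg] := (measurable_int mu ifA, measurable_int mu igA).
rewrite !ge0_integralD//; do ?[exact: measurable_funepos|exact: measurable_funeneg].
rewrite [in X in X <-> _]integralE [in X in _ = X]integralE.
have := integrable_fin_num mA (integrable_funepos mA ifA).
have := integrable_fin_num mA (integrable_funeneg mA ifA).
have := integrable_fin_num mA (integrable_funepos mA igA).
have := integrable_fin_num mA (integrable_funeneg mA igA).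
move=> /fineK <- /fineK <- /fineK <- /fineK <-.
rewrite -!EFinB -!EFinD; split=> -[] E; congr EFin; lra.
Qed.

(** The conditional probability is the density on [<<s H >>] of the measure [Q] restricted to
    [A]. *)
Lemma cond_prob_version (Q : probability T R) (H : set (set T)) (A : set T) :
  H `<=` measurable -> measurable A ->
  exists Y : T -> R, [/\ measurable_wrt H Y, forall x, (0 <= Y x)%R,
    Q.-integrable setT (EFin \o Y) &
    forall B, <<s H >> B -> Q (A `&` B) = \int[Q]_(x in B) (Y x)%:E].
Proof.
move=> Hm mA.
have QA : Q A < +oo by rewrite ltey_eq fin_num_measure.
have [B HB QB0|Y [mY Y0 iY YE]] := @radon_nikodym_sub _ _ _ H Q (mfrestr mA QA) Hm.
  apply: (@subset_measure0 _ _ _ Q (B `&` A) B) => //.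
  - by apply: measurableI => //; exact: g_sigma_algebra_sub HB.
  - exact: g_sigma_algebra_sub HB.
by exists Y; split => // B HB; rewrite setIC -YE.
Qed.

End integral_lemmas.

(** * The H-hypothesis and its relation to martingales *)

Section immersion.
Context d (T : measurableType d) (R : realType).
Implicit Types (P Q : probability T R) (F G : {nonneg R} -> set (set T)).

(* [b] is a version of [Q(B | F s)] and of [Q(B | F t)] for every [t >= s]:
   under [Q], the future of [F] and [G s] are conditionally independent given
   [F s]. *)
Definition H_hypothesis Q F G := forall s B, G s B ->
  exists b : T -> R, [/\ measurable_wrt (F s) b, forall w, 0 <= b w,
    Q.-integrable setT (EFin \o b) &
    forall t A, F t A -> Q (A `&` B) = (\int[Q]_(w in A) (b w)%:E)%E].

Lemma filtration_g_sigma_algebra F t : filtration F -> <<s F t >> = F t.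
Proof. by move=> filF; apply: sigma_algebra_id; exact: filtration_sigma. Qed.

Lemma martingale_H_hypothesis P Q F G :
  filtration F -> (forall s, F s `<=` G s) -> (forall s, G s `<=` measurable) ->
  (forall M, martingale P F M -> martingale Q G M) -> H_hypothesis Q F G.
Proof.
move=> filF FG Gm PQ s B GB; have mB := Gm _ _ GB.
have Fm r : F r `<=` measurable := filtration_sub filF (t := r).
have [b [mb b0 ib bE]] := cond_prob_version Q (Fm s) mB.
exists b; split => // t A FtA.
(* [H_hypothesis] also covers [t < s]; passing to [u] treats both orders at once, since [A] lies in
   [F u] as well. *)
pose u := Order.max s t.
have su : s <= u by rewrite le_max lexx.
have FuA : F u A by apply: (filtration_mono filF) FtA; rewrite le_max lexx orbT.
have mA := Fm _ _ FuA.
(* [P(A | F r)], taken to be exactly [\1_A] from time [u] on: versions under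
   [P] mean nothing under [Q]. *)
have /choice[N NP] r : exists Y : T -> R, [/\ measurable_wrt (F r) Y,
    forall w, 0 <= Y w, P.-integrable setT (EFin \o Y),
    forall C, F r C -> P (A `&` C) = (\int[P]_(w in C) (Y w)%:E)%E &
    u <= r -> Y = \1_A].
  have [ur|ru] := leP u r.
    have FrA := filtration_mono filF ur FuA.
    exists \1_A; split => //.
    - apply: (@measurable_indic _ (g_sigma_algebraType (F r))).
      exact: sub_sigma_algebra.
    - exact: integrable_indic.
    - by move=> C FrC; rewrite integral_indic//; exact: Fm FrC.
  have [Y [mY Y0 iY YE]] := cond_prob_version P (Fm r) mA.
  by exists Y; split => // C FrC; rewrite YE//; exact: sub_sigma_algebra.
have martN : martingale P F N.
  split=> [r|r|r v rv]; [by case: (NP r)|by case: (NP r)|].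
  have [mr _ ir rE _] := NP r; have [_ _ _ vE _] := NP v.
  split => // C FrC.
  by rewrite -rE// -vE//; exact: filtration_mono rv _ FrC.
have [_ iN /(_ _ _ su)[_ _ NE]] := PQ _ martN.
have [ms s0 _ _ _] := NP s; have [_ _ _ _ /(_ (lexx u)) Nu] := NP u.
have NsE C : G s C -> (\int[Q]_(w in C) (N s w)%:E = Q (A `&` C))%E.
  by move=> GC; rewrite NE// Nu integral_indic//; exact: Gm GC.
have FsT : <<s F s >> setT by exact: (@measurableT _ (g_sigma_algebraType (F s))).
(* The chain is Q(A n B) = E[N s 1_B] = E[N s b] = E[1_A b]: first [b] replaces [\1_B] against the
   [F s]-measurable [N s], then [\1_A] replaces [N s] against the [F s]-measurable [b]. *)
rewrite -NsE// -[B in LHS]setTI -integral_mul_indic.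
rewrite (@ge0_integral_mul_sub _ _ _ (F s) Q _ (EFin \o b))//; first last.
- exact/measurable_EFinP.
- move=> C FC; rewrite -bE// integral_indic//.
  exact: (g_sigma_algebra_sub (Fm s)) FC.
- exact: integrable_indic.
under eq_integral do rewrite muleC.
rewrite (@ge0_integral_mul_sub _ _ _ (F s) Q (EFin \o N s)
  (fun w => (\1_A w)%:E))//; first last.
- exact/measurable_EFinP.
- move=> C FC; rewrite filtration_g_sigma_algebra// in FC.
  by rewrite NsE ?integral_indic//; [exact: Fm FC|exact: FG].
- exact: integrable_indic.
by rewrite [LHS](integral_mul_indic Q setT A (EFin \o b)) setTI.
Qed.

(** For [B] in [G s], its conditional probability [b] still serves at time [t], so E[M t 1_B] =
    E[M t b]; as [b] is [F s]-measurable, the martingale property replaces [M t] by [M s]. *)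
Lemma H_hypothesis_immersed Q F G :
  filtration F -> (forall s, F s `<=` G s) -> (forall s, G s `<=` measurable) ->
  H_hypothesis Q F G -> immersed Q F G.
Proof.
move=> filF FG Gm HQ M [mM iM ME].
have Fm r : F r `<=` measurable := filtration_sub filF (t := r).
have mMG t : measurable_wrt (G t) (M t).
  by apply: measurable_fun_sub (mM t) => A /FG; exact: sub_sigma_algebra.
split => // s t st; split => // B GB; have mB := Gm _ _ GB.
have [b [mb b0 ib bE]] := HQ s B GB.
have fbE r (f : T -> \bar R) : measurable_fun [set: g_sigma_algebraType (F r)]
    (f : g_sigma_algebraType (F r) -> \bar R) -> (forall w, 0 <= f w)%E ->
    (\int[Q]_(w in B) f w = \int[Q]_w (f w * (b w)%:E))%E.
  move=> mf f0; rewrite -[B in LHS]setTI -integral_mul_indic.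
  rewrite (@ge0_integral_mul_sub _ _ _ (F r) Q _ (EFin \o b))//.
  - exact: integrable_indic.
  - move=> C FC; rewrite integral_indic//; last first.
      exact: (g_sigma_algebra_sub (Fm r)) FC.
    rewrite filtration_g_sigma_algebra// in FC.
    by rewrite -(bE r) 1?setIC.
  - exact: (@measurableT _ (g_sigma_algebraType (F r))).
have mMt r : r <= t -> measurable_fun [set: g_sigma_algebraType (F t)]
    ((EFin \o M r) : g_sigma_algebraType (F t) -> \bar R).
  move=> rt; apply/measurable_EFinP; apply: measurable_fun_sub (mM r) => A FrA.
  by apply: sub_sigma_algebra; exact: filtration_mono rt _ FrA.
have [ms mt] := (mMt s st, mMt t (lexx t)).
(* Rearranged this way, both integrands are nonnegative and [F t]-measurable, so [fbE] applies to
   each. On sets of [F s] the same rearrangement is undone to recover the martingale identity. *)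
apply/(eq_integral_funeposneg mB (iM s) (iM t)).
rewrite (fbE t)//; last 2 first.
- apply: emeasurable_funD; [exact: measurable_funepos|exact: measurable_funeneg].
- by move=> w; exact: adde_ge0.
rewrite (fbE t)//; last 2 first.
- apply: emeasurable_funD; [exact: measurable_funeneg|exact: measurable_funepos].
- by move=> w; exact: adde_ge0.
under eq_integral do rewrite muleC; under [RHS]eq_integral do rewrite muleC.
apply: (@ge0_integral_mul_sub _ _ _ (F s) Q) => //.
- by move=> w; exact: adde_ge0.
- apply: integrableD => //; [exact: integrable_funepos|exact: integrable_funeneg].
- by move=> w; exact: adde_ge0.
- apply: integrableD => //; [exact: integrable_funeneg|exact: integrable_funepos].
- move=> C FC; rewrite filtration_g_sigma_algebra// in FC.
  apply/(eq_integral_funeposneg _ (iM s) (iM t)); first exact: Fm FC.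
  by have [_ _ ->] := ME s t st.
- exact/measurable_EFinP.
- exact: (@measurableT _ (g_sigma_algebraType (F s))).
Qed.



(** * Transfer of the H-hypothesis to an equivalent measure *)

Lemma H_hypothesis_generated Q F G s B : filtration F -> G s `<=` measurable ->
  H_hypothesis Q F G -> G s B ->
  exists b : T -> R, [/\ measurable_wrt (F s) b, forall w, 0 <= b w,
    Q.-integrable setT (EFin \o b) &
    forall A, <<s \bigcup_t F t >> A ->
      Q (A `&` B) = (\int[Q]_(w in A) (b w)%:E)%E].
Proof.
move=> filF Gm HQ GB; have mB := Gm _ GB.
have Hm : \bigcup_t F t `<=` measurable.
  by move=> A [t _]; exact: filtration_sub.
have [b [mb b0 ib bE]] := HQ s B GB; exists b; split => // A HA.
have i0 w : (0 <= (\1_B w : R)%:E)%E by [].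
have b0' w : (0 <= (EFin \o b) w)%E by rewrite lee_fin.
have iB := integrable_indic Q mB.
have H_T : (\bigcup_t F t) setT.
  by exists 0%:nng => //; rewrite -filtration_g_sigma_algebra//;
     exact: (@measurableT _ (g_sigma_algebraType (F 0%:nng))).
(* Both sides of the goal become finite measures in [A]. They agree on the union of the [F t], which
   is stable under intersection because the filtration is increasing, hence on the sigma-algebra it
   generates. *)
have E C : measurable C -> Q (C `&` B) = density_measure i0 iB C.
  by move=> mC; rewrite /density_measure integral_indic// setIC.
rewrite E; last exact: g_sigma_algebra_sub HA.
apply: (g_sigma_algebra_measure_unique _ Hm (fun=> setT) _ _
  (density_measure i0 iB) (density_measure b0' ib)) => //.
- by rewrite bigcup_const.
- move=> C D [r _ FC] [v _ FD]; exists (Order.max r v) => //.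
  rewrite -filtration_g_sigma_algebra//.
  apply: (@measurableI _ (g_sigma_algebraType (F (Order.max r v)))).
    apply: sub_sigma_algebra; apply: (filtration_mono filF) FC.
    by rewrite le_max lexx.
  apply: sub_sigma_algebra; apply: (filtration_mono filF) FD.
  by rewrite le_max lexx orbT.
- move=> C [t _ FC]; transitivity (Q (C `&` B)); last exact: bE FC.
  by rewrite E//; apply: Hm; exists t.
- by move=> _; rewrite ltey_eq fin_num_measure.
Qed.

Lemma equivalent_measure_extending P Q (H : set (set T)) :
  H `<=` measurable -> equivalent_measures Q P ->
  exists (Q' : probability T R) (Z : T -> R),
    [/\ equivalent_measures Q' P, forall A, <<s H >> A -> Q' A = P A,
      measurable_wrt H Z, forall w, 0 <= Z w &
      forall A (f : T -> \bar R), measurable A -> measurable_fun setT f ->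
        (forall w, 0 <= f w)%E ->
        (\int[Q']_(w in A) f w = \int[Q]_(w in A) (f w * (Z w)%:E))%E].
Proof.
move=> Hm [QP PQ].
have [B HB QB0|Z [mZ Z0 iZ ZE]] := @radon_nikodym_sub _ _ _ H Q P Hm.
  have /null_content_dominatesP PQ0 := PQ; apply: PQ0 => //.
  exact: g_sigma_algebra_sub HB.
have Z0' w : (0 <= (EFin \o Z) w)%E by rewrite lee_fin.
pose nu := density_measure Z0' iZ.
have nuT : nu setT = 1%E.
  have HT : <<s H >> setT by exact: (@measurableT _ (g_sigma_algebraType H)).
  by rewrite /nu /density_measure -ZE//; exact: probability_setT.
pose pm := Measure_isProbability.Build _ _ _ nu nuT.
pose Q' : probability T R := HB.pack (density_measure Z0' iZ) pm.
have mZT : measurable_fun setT (EFin \o Z) := measurable_int Q iZ.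
have Q'Q : Q' `<< Q.
  apply/null_content_dominatesP => B mB QB0; apply: null_set_integral => //.
  exact: measurable_funTS.
(* [P W] is the integral of [Z] over [W], hence zero, and [Q] is dominated by [P]: so [Z] is
   positive [Q]-almost surely, which makes [Q] dominated by [Q']. *)
pose W := Z @^-1` [set 0].
have HW : <<s H >> W by rewrite -[W]setTI; exact: mZ.
have QW0 : Q W = 0%E.
  have /null_content_dominatesP QP0 := QP; apply: QP0.
    exact: g_sigma_algebra_sub HW.
  by apply: (etrans (ZE W HW)); apply: integral0_eq => w /= ->.
have QQ' : Q `<< Q'.
  apply/null_content_dominatesP => B mB Q'B0.
  have /(ae_eq_integral_abs Q mB (measurable_funTS mZT))[N [mN QN0 BN]] :
      (\int[Q]_(w in B) `|(EFin \o Z) w| = 0)%E.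
    by under eq_integral do rewrite gee0_abs//.
  have mW : measurable W by exact: g_sigma_algebra_sub HW.
  apply: (@subset_measure0 _ _ _ Q B (W `|` N)) => //.
  - exact: measurableU.
  - move=> w Bw; have [Ww|NWw] := pselect (W w); [by left|right].
    by apply: BN => /= /(_ Bw) [] /NWw.
  - exact: null_set_setU.
exists Q', Z; split => //.
- by split; [exact: null_dominates_trans QP|exact: null_dominates_trans PQ QQ'].
- by move=> A HA; rewrite ZE.
- by move=> A f mA mf f0; exact: ge0_integral_density_measure.
Qed.

(** Each integral in the definition of a martingale has an [F t]-measurable integrand and domain for
    some [t], so it depends only on the measure on [F t]. *)
Lemma martingale_eq_on P Q F M :
  filtration F -> (forall t A, F t A -> P A = Q A) ->
  martingale P F M -> martingale Q F M.
Proof.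
move=> filF PQ [mM iM ME].
have Fm r : F r `<=` measurable := filtration_sub filF (t := r).
have intPQ t A (f : T -> \bar R) : measurable_fun [set: g_sigma_algebraType (F t)]
    (f : g_sigma_algebraType (F t) -> \bar R) -> F t A ->
    (\int[P]_(w in A) f w = \int[Q]_(w in A) f w)%E.
  move=> mf FtA; apply: (eq_integral_sub (Fm t) _ _ mf).
    by move=> B; rewrite filtration_g_sigma_algebra//; exact: PQ.
  exact: sub_sigma_algebra.
have mMt t : measurable_fun [set: g_sigma_algebraType (F t)]
    ((EFin \o M t) : g_sigma_algebraType (F t) -> \bar R).
  by apply/measurable_EFinP; exact: mM.
have iMQ t : Q.-integrable setT (EFin \o M t).
  have /integrableP[mMtT iMt] := iM t; apply/integrableP; split => //.
  rewrite -(intPQ t)//.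
    exact: (measurableT_comp (@abse_measurable R setT) (mMt t)).
  rewrite -filtration_g_sigma_algebra//.
  exact: (@measurableT _ (g_sigma_algebraType (F t))).
split => // s t st; split => // A FsA.
have [_ _ /(_ A FsA)] := ME s t st.
by rewrite (intPQ s)// (intPQ t)//; exact: filtration_mono st _ FsA.
Qed.

(** The density [Z] is measurable for the sigma-algebra generated by all the [F t], and [b] is the
    conditional probability of [B] given that whole sigma-algebra. In Bayes' formula [Z] therefore
    cancels, and the same [b] works under [Q']. *)
Lemma H_hypothesis_change_measure P Q F G :
  filtration F -> (forall s, G s `<=` measurable) ->
  equivalent_measures Q P -> H_hypothesis Q F G ->
  exists Q' : probability T R, [/\ equivalent_measures Q' P,
    forall t A, F t A -> Q' A = P A & H_hypothesis Q' F G].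
Proof.
move=> filF Gm QP HQ.
have Hm : \bigcup_t F t `<=` measurable.
  by move=> A [t _]; exact: filtration_sub.
have [Q' [Z [Q'P Q'E mZ Z0 intQ']]] := equivalent_measure_extending Hm QP.
exists Q'; split => //.
  by move=> t A FtA; apply: Q'E; apply: sub_sigma_algebra; exists t.
move=> s B GB; have mB := Gm _ _ GB.
have [b [mb b0 ib bE]] := H_hypothesis_generated filF (Gm s) HQ GB.
have mbT : measurable_fun setT (EFin \o b) := measurable_int Q ib.
have key A : <<s \bigcup_t F t >> A ->
    Q' (A `&` B) = (\int[Q']_(w in A) (b w)%:E)%E.
  move=> HA; have mA := g_sigma_algebra_sub Hm HA.
  rewrite (intQ' A (EFin \o b))// setIC -integral_indic//.
  rewrite (intQ' A (fun w => (\1_B w)%:E))//;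
    last exact/measurable_EFinP/measurable_indic.
  under eq_integral do rewrite muleC; under [RHS]eq_integral do rewrite muleC.
  apply: (@ge0_integral_mul_sub _ _ _ (\bigcup_t F t) Q) => //.
  - exact: integrable_indic.
  - move=> C HC; rewrite integral_indic//; last exact: g_sigma_algebra_sub HC.
    by rewrite -bE// setIC.
  - exact/measurable_EFinP.
exists b; split => //.
(* Integrability under [Q] does not pass to [Q'] by itself; instead [key] on the whole space gives
   [Q' B] as the integral of [b]. *)
- apply/integrableP; split => //.
  under eq_integral do rewrite gee0_abs ?lee_fin//.
  rewrite -key ?ltey_eq ?fin_num_measure//; first exact: measurableI.
  exact: (@measurableT _ (g_sigma_algebraType _)).
- by move=> t A FtA; apply: key; apply: sub_sigma_algebra; exists t.
Qed.

End immersion.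

(** * The progressive enlargement and the equivalence *)

Lemma progressive_enlargement_sub d (T : measurableType d) (R : realType)
    (F : {nonneg R} -> set (set T)) (tau : T -> \bar R) t :
  filtration F -> F t `<=` progressive_enlargement F tau t.
Proof.
move=> filF A FtA s /= ts; apply: sub_sigma_algebra; left.
exact: filtration_mono (ltW ts) _ FtA.
Qed.

Lemma progressive_enlargement_measurable d (T : measurableType d) (R : realType)
    (F : {nonneg R} -> set (set T)) (tau : T -> \bar R) t :
  filtration F -> measurable_fun setT tau ->
  progressive_enlargement F tau t `<=` measurable.
Proof.
(* Any single later time bounds the intersection; [t + 1] is one. *)
move=> filF mtau A GA; have ts : t < (t%:num + 1)%:nng by rewrite -num_lt/= ltrDl.
apply: g_sigma_algebra_sub (GA _ ts) => B [|].
  exact: filtration_sub.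
move=> [C mC <-].
exact: (measurable_mine mtau (measurable_cst _)).
Qed.

Theorem proposition4p4 (R : realType) (d : measure_display)
    (T : measurableType d) (P : probability T R)
    (F : {nonneg R} -> set (set T)) (tau : T -> \bar R)
    (filF : filtration F) (usualF : usual_conditions P F)
    (rt_tau : random_time tau) :
  immersion_measures P F tau !=set0 <->
  exists Q : probability T R,
    equivalent_measures Q P /\
    (forall M : {nonneg R} -> T -> R,
       martingale P F M -> martingale Q (progressive_enlargement F tau) M).
Proof.
set G := progressive_enlargement F tau.
have FG s : F s `<=` G s by exact: progressive_enlargement_sub.
have Gm s : G s `<=` measurable.
  exact: progressive_enlargement_measurable (random_time_measurable rt_tau).
split=> [[Q [QP immQ]]|[Q [QP PQ]]].
  (* Immersion is the premise of this lemma with [Q] in the role of both measures. *)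
  have HQ := martingale_H_hypothesis filF FG Gm immQ.
  have [Q' [Q'P Q'E HQ']] := H_hypothesis_change_measure filF Gm QP HQ.
  exists Q'; split => // M martM.
  apply: H_hypothesis_immersed HQ' _ _ => //.
  by apply: martingale_eq_on martM => // t A /Q'E.
exists Q; split => //; apply: H_hypothesis_immersed => //.
exact: martingale_H_hypothesis filF FG Gm PQ.
Qed.
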